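(* Let $a \in \mathbb{Z}^n$ be non-zero and $b\in\mathbb{Z}$, and let $\mathcal{P}_I = \operatorname{Conv}(\{x\in\mathbb{R}^n : a^\top x = b,\ x\ge 0\}\cap\mathbb{Z}^n)$ be the integer hull of the knapsack polytope. Then every vertex $v$ of $\mathcal{P}_I$ satisfies $|\operatorname{supp}(v)| \le \log(3.51\cdot \lVert a[\operatorname{supp}(v)]\rVert_2)$.
   Context: All logarithms are base 2. Entries of $a$ may be negative. $\operatorname{supp}(v)=\{i: v_i\neq 0\}$; for an index set $S$, $a[S]$ denotes the subvector of $a$ consisting of the entries indexed by $S$. A vertex of $\mathcal{P}_I$ is a point $v\in\mathcal{P}_I$ with $v\notin\operatorname{Conv}(\mathcal{P}_I\setminus\{v\})$. *)

(* Defs.v *)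
From HB Require Import structures.
From mathcomp Require Import all_boot all_order all_algebra.
From mathcomp Require Import all_classical all_reals all_analysis.

Set Implicit Arguments.
Unset Strict Implicit.
Unset Printing Implicit Defensive.

Import Order.TTheory GRing.Theory Num.Theory.

Local Open Scope classical_set_scope.
Local Open Scope ring_scope.

Definition conv_hull (R : realType) (E : lmodType R) (A : set E) : set E :=
  smallest (@convex_set R E) A.

Definition vertex (R : realType) (E : lmodType R) (P : set E) (v : E) : Prop :=
  P v /\ ~ conv_hull (P `\ v) v.

Definition knapsack (R : realType) (n : nat) (a : 'rV[int]_n) (b : int) :
    set 'rV[R]_n :=
  [set x | \sum_(i < n) (a 0 i)%:~R * x 0 i = b%:~R /\ forall i, 0 <= x 0 i].

Definition integer_points (R : realType) (n : nat) : set 'rV[R]_n :=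
  [set x | forall i, x 0 i \is a Num.int].

Definition integer_hull (R : realType) (n : nat) (P : set 'rV[R]_n) :
    set 'rV[R]_n :=
  conv_hull (P `&` @integer_points R n).

Definition supp (R : realType) (n : nat) (v : 'rV[R]_n) : {set 'I_n} :=
  [set i | v 0 i != 0]%SET.

(* a[S], with the entries indexed by S kept in increasing order of index. *)
Definition subvector (T : Type) (n : nat) (a : 'rV[T]_n) (S : {set 'I_n}) :
    'rV[T]_#|S| :=
  \row_(j < #|S|) a 0 (enum_val j).

(* Euclidean norm; the library norm on matrices is the sup norm. *)
Definition norm2 (R : realType) (m : nat) (u : 'rV[int]_m) : R :=
  Num.sqrt (\sum_(j < m) (u 0 j)%:~R ^+ 2).

(* [ln x = 0] for [x <= 0], so [log2 0 = 0]; a bound by [log2] of the norm of the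
   empty vector (the vertex 0) is thus a bound by 0. *)
Definition log2 (R : realType) (x : R) : R := ln x / ln 2.

(* Main.v *)
Require Import Defs.
From HB Require Import structures.
From mathcomp Require Import all_boot all_order all_algebra.
From mathcomp Require Import zify ring lra.
From mathcomp Require Import all_classical all_reals all_analysis.

Import Order.TTheory GRing.Theory Num.Theory.

Local Open Scope classical_set_scope.
Local Open Scope ring_scope.

(** Let [s] be the size of the support of the vertex [v]. The [2 ^ s] subset sums of
    the entries of [a] on the support are distinct, since two equal ones would make
    [v] the midpoint of two other feasible integer points. Hence so are the [2 ^ s]
    signed sums with all signs [+1] or [-1]; being of equal parity, they are at
    distance at least 2 from each other, so their mean square is at least
    [(4 ^ s - 1) / 3]. But this mean square is the squared norm [q] of [a] on the
    support. Therefore [4 ^ s <= 3 q + 1 <= 4 q] for [s > 0], which gives the bound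
    even with the constant 2 in place of 3.51. *)

(** * Sums of squares over distinct integers *)

Lemma sum_sqr_arith_progression (c : int) (N : nat) :
  3 * \sum_(0 <= j < N) (2 * j%:Z + c) ^+ 2 =
  2 * N%:Z * (N%:Z - 1) * (2 * N%:Z - 1) + 6 * c * N%:Z * (N%:Z - 1)
  + 3 * c ^+ 2 * N%:Z.
Proof.
elim: N => [|N IHN]; first by rewrite big_geq // !mulr0 !mul0r.
rewrite big_nat_recr //= mulrDr IHN intS; ring.
Qed.

(* The sum is smallest when [X] is an interval [J] centred at [t / 2]. With
   [N = size X], the summand minus [N ^ 2] is nonpositive on [J] and nonnegative
   off [J], which compares [X] with [J] term by term. *)
Lemma sum_sqr_deviation_ge (X : seq int) (t : int) : uniq X ->
  (size X)%:Z * ((size X)%:Z ^+ 2 - 1) <= 3 * \sum_(x <- X) (2 * x - t) ^+ 2.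
Proof.
move=> uX; set N := size X.
(* [j0] is the least integer with [2 * j0 > t - N], so [J] consists of the [N] integers [x] with
   [- N < 2 * x - t <= N]. *)
pose j0 : int := ((t - N%:Z) %/ 2)%Z + 1.
have j0_ge : t - N%:Z + 1 <= 2 * j0 by rewrite /j0; lia.
have j0_le : 2 * j0 <= t - N%:Z + 2 by rewrite /j0; lia.
pose J : seq int := [seq j0 + k%:Z | k <- index_iota 0 N].
have memJ (x : int) : (x \in J) = (j0 <= x < j0 + N%:Z).
  apply/mapP/idP => [[k] | hx].
    by rewrite mem_index_iota => hk ->; lia.
  by exists `|x - j0|%N; [rewrite mem_index_iota; lia | lia].
have uJ : uniq J by rewrite map_inj_uniq ?iota_uniq // => x y; lia.
pose G (x : int) : int := (2 * x - t) ^+ 2 - N%:Z ^+ 2.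
have G_le0 (x : int) : x \in J -> G x <= 0.
  rewrite memJ /G => /andP[h1 h2].
  have -> : (2 * x - t) ^+ 2 - N%:Z ^+ 2 =
    - ((N%:Z - (2 * x - t)) * (N%:Z + (2 * x - t))) by ring.
  by rewrite oppr_le0; apply: mulr_ge0; lia.
have G_ge0 (x : int) : x \notin J -> 0 <= G x.
  rewrite memJ /G => hx.
  have -> : (2 * x - t) ^+ 2 - N%:Z ^+ 2 =
    (2 * x - t - N%:Z) * (2 * x - t + N%:Z) by ring.
  have [h|h] : 2 * x - t <= - N%:Z \/ N%:Z <= 2 * x - t by lia.
  - by apply: mulr_le0; lia.
  - by apply: mulr_ge0; lia.
have sum_G s : \sum_(x <- s) G x =
    \sum_(x <- s) (2 * x - t) ^+ 2 - (size s)%:Z * N%:Z ^+ 2.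
  rewrite /G sumrB big_const_seq count_predT iter_addr_0.
  by rewrite -[(size s)%:Z]natz mulr_natl.
have sum_le : \sum_(x <- J) G x <= \sum_(x <- X) G x.
  rewrite (bigID (mem X)) [leRHS](bigID (mem J)) /=.
  have -> : \sum_(x <- J | x \in X) G x = \sum_(x <- X | x \in J) G x.
    rewrite -[LHS]big_filter -[RHS]big_filter; apply: perm_big.
    apply: uniq_perm; rewrite ?filter_uniq // => x.
    by rewrite !mem_filter andbC.
  rewrite lerD2l; apply: (@le_trans _ _ 0).
    by rewrite big_seq_cond; apply: sumr_le0 => x /andP[xJ _]; apply: G_le0.
  by apply: sumr_ge0 => x /G_ge0.
(* As [J] and [X] have equal size, the shifts by [N ^ 2] cancel. *)
have sizeJ : size J = N by rewrite size_map size_iota subn0.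
rewrite !sum_G sizeJ lerD2r in sum_le.
apply: le_trans (ler_wpM2l _ sum_le) => //.
rewrite big_map.
rewrite (eq_bigr (fun k : nat => (2 * k%:Z + (2 * j0 - t)) ^+ 2)); last first.
  by move=> k _; congr (_ ^+ 2); ring.
rewrite sum_sqr_arith_progression.
(* The two parities of [t - N]: equality holds in the odd case, and there is a slack of [3 * N] in
   the even one. *)
have [e|e] : 2 * j0 - t = 1 - N%:Z \/ 2 * j0 - t = 2 - N%:Z by lia.
all: rewrite e -subr_ge0.
- by rewrite [leRHS](_ : _ = 0) //; ring.
- by rewrite [leRHS](_ : _ = 3 * N%:Z) //; ring.
Qed.

(** * Second moment of the signed sums *)

Lemma card_finset (I : finType) : #|{set I}| = (2 ^ #|I|)%N.
Proof. by rewrite -[LHS]cardsT -powersetT card_powerset cardsT. Qed.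

(** Each term is the square of a sum of the [c i] with signs; once it is expanded, the cross terms
    cancel over all [A]. *)
Lemma sum_sqr_signed_sums (I : finType) (c : I -> int) :
  \sum_(A : {set I}) (2 * \sum_(i in A) c i - \sum_i c i) ^+ 2 =
  2 ^+ #|I| * \sum_i c i ^+ 2.
Proof.
pose s (A : {set I}) (i : I) : int := if i \in A then 1 else -1.
have sE (A : {set I}) : 2 * \sum_(i in A) c i - \sum_i c i = \sum_i s A i * c i.
  rewrite (bigID (mem A) predT) [RHS](bigID (mem A)) /=.
  rewrite [X in _ = X + _](eq_bigr c) => [|i iA]; last by rewrite /s iA mul1r.
  rewrite [X in _ = _ + X](eq_bigr (fun i => - c i)) => [|i iA]; last first.
    by rewrite /s (negbTE iA) mulN1r.
  by rewrite sumrN; ring.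
have ss A i : s A i * s A i = 1 by rewrite /s; case: ifP.
have s_orth i j : i != j -> \sum_(A : {set I}) s A i * s A j = 0.
  move=> ij.
  (* Toggling [i] negates [s A i] and keeps [s A j], so the sum is its own opposite. *)
  pose flip (A : {set I}) := if i \in A then (A :\ i)%SET else (i |: A)%SET.
  have flipK : involutive flip.
    move=> A; rewrite /flip; case: (boolP (i \in A)) => iA.
      by rewrite setD11 finset.setD1K.
    by rewrite setU11 setU1K.
  have flipi A : s (flip A) i = - s A i.
    rewrite /flip /s; case: (boolP (i \in A)) => iA.
      by rewrite setD11.
    by rewrite setU11 opprK.
  have flipj A : s (flip A) j = s A j.
    rewrite /flip /s; case: (boolP (i \in A)) => iA.
      by rewrite in_setD1 eq_sym ij.
    by rewrite in_setU1 eq_sym (negbTE ij).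
  set S := \sum_A _.
  suff : S = - S by lia.
  rewrite {1}/S (reindex_inj (inv_inj flipK)) -sumrN; apply: eq_bigr => A _.
  by rewrite flipi flipj mulNr.
under eq_bigr => A _.
  rewrite sE expr2 mulr_suml; under eq_bigr do rewrite mulr_sumr.
  over.
rewrite exchange_big mulr_sumr; apply: eq_bigr => i _ /=.
rewrite exchange_big (bigD1 i) //= [X in _ + X]big1 ?addr0; last first.
  move=> j ji; under eq_bigr do rewrite mulrACA.
  by rewrite -mulr_suml s_orth 1?eq_sym // mul0r.
under eq_bigr do rewrite mulrACA ss mul1r.
rewrite sumr_const card_finset.
by rewrite -[LHS]mulr_natl natrX.
Qed.

Lemma distinct_subset_sums_norm (I : finType) (c : I -> int) :
  injective (fun A : {set I} => \sum_(i in A) c i) ->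
  4 ^+ #|I| <= 3 * \sum_i c i ^+ 2 + 1.
Proof.
move=> inj_c.
pose X : seq int := [seq \sum_(i in A) c i | A : {set I}].
have uX : uniq X by rewrite map_inj_uniq ?enum_uniq.
have sizeX : (size X)%:Z = 2 ^+ #|I|.
  by rewrite size_map -cardE card_finset -natz natrX.
have := sum_sqr_deviation_ge X (\sum_i c i) uX.
rewrite sizeX big_map big_enum /= sum_sqr_signed_sums mulrCA.
by rewrite ler_pM2l ?exprn_gt0 // -exprM mulnC exprM lerBlDr.
Qed.

(** * Vertices of convex hulls and of the integer hull *)

Lemma convex_set_midpoint (R : realType) (E : lmodType R) (A : set E) (v z : E) :
  convex_set A -> A (v + z) -> A (v - z) -> A v.
Proof.
move=> cA A1 A2.
have h0 : (0 : R) <= 2^-1 by rewrite invr_ge0.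
have h1 : (2^-1 : R) <= 1 by rewrite invf_le1 ?ler1n.
have := cA (v + z) (v - z) (Itv01 h0 h1) (mem_set A1) (mem_set A2).
move/set_mem; rewrite [conv _ _ _](_ : _ = v) //.
change (2^-1 *: (v + z) + (1 - 2^-1) *: (v - z) = v).
have -> : 1 - 2^-1 = 2^-1 :> R by lra.
by rewrite -scalerDr addrACA subrr addr0 -mulr2n
  -[v *+ 2]scaler_nat scalerA mulVf ?scale1r ?pnatr_eq0.
Qed.

Lemma conv_hull_convex (R : realType) (E : lmodType R) (A : set E) :
  convex_set (conv_hull A).
Proof.
move=> x y l /set_mem hx /set_mem hy; apply: mem_set => M [cM AM].
have [Mx My] := (hx M (conj cM AM), hy M (conj cM AM)).
exact: set_mem (cM _ _ _ (mem_set Mx) (mem_set My)).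
Qed.

(** Otherwise [A] lies in its hull without [v], whose own hull then contains [v]. *)
Lemma vertex_conv_hull_mem (R : realType) (E : lmodType R) (A : set E) (v : E) :
  vertex (conv_hull A) v -> A v.
Proof.
move=> [vA nv]; apply: contrapT => nAv; apply: nv.
apply: (sub_smallest2r _ _) vA; first exact: conv_hull_convex.
move=> x Ax; split; first exact: sub_gen_smallest.
by move=> xv; apply: nAv; rewrite -xv.
Qed.

Lemma vertex_conv_hull_extreme (R : realType) (E : lmodType R) (A : set E)
    (v z : E) :
  vertex (conv_hull A) v -> A (v + z) -> A (v - z) -> z = 0.
Proof.
move=> [vA nv] A1 A2; apply: contrapT => z0; apply: nv.
apply: (convex_set_midpoint _ _ _ v z (conv_hull_convex _ _ _)).
- apply: sub_gen_smallest; split; first exact: sub_gen_smallest.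
  by move=> /= /eqP; rewrite -subr_eq0 addrAC subrr add0r => /eqP.
- apply: sub_gen_smallest; split; first exact: sub_gen_smallest.
  by move=> /= /eqP; rewrite -subr_eq0 addrAC subrr sub0r oppr_eq0 => /eqP.
Qed.

(* If two subsets of the support had the same sum, moving [v] by the difference
   of their indicators, in either direction, would stay feasible. *)
Lemma vertex_knapsack_subset_sums (R : realType) (n : nat) (a : 'rV[int]_n)
    (b : int) (v : 'rV[R]_n) (A B : {set 'I_n}) :
  vertex (integer_hull (@knapsack R n a b)) v ->
  A \subset supp v -> B \subset supp v ->
  \sum_(i in A) a 0 i = \sum_(i in B) a 0 i -> A = B.
Proof.
move=> v_vertex /fintype.subsetP sA /fintype.subsetP sB sumAB.
have [[av v_ge0] v_int] := vertex_conv_hull_mem _ _ _ _ v_vertex.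
(* Integrality leaves room to subtract an indicator of a subset of the support. *)
have v_ge1 i : i \in supp v -> 1 <= v 0 i.
  rewrite inE => vi0; move: (v_ge0 i) vi0; have /intrP[m ->] := v_int i.
  by rewrite ler0z intr_eq0 ler1z; lia.
pose ind (C : {set 'I_n}) : 'rV[R]_n := \row_i (i \in C)%:R.
have sum_ind C : \sum_(i < n) (a 0 i)%:~R * ind C 0 i = (\sum_(i in C) a 0 i)%:~R.
  rewrite rmorph_sum [RHS]big_mkcond /=; apply: eq_bigr => i _.
  by rewrite mxE; case: ifP => _; rewrite ?mulr1 ?mulr0.
have feasible (C D : {set 'I_n}) : {subset D <= supp v} ->
    \sum_(i in C) a 0 i = \sum_(i in D) a 0 i ->
    (@knapsack R n a b `&` @integer_points R n) (v + (ind C - ind D)).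
  move=> sD sumCD; split; last first.
    by move=> i; rewrite !mxE rpredD ?rpredB ?rpred_nat.
  split => [|i].
    rewrite -[RHS]addr0 -[in RHS](subrr (\sum_(i in D) a 0 i)%:~R) -[in RHS]av.
    rewrite -{1}sumCD -!sum_ind -sumrB -big_split; apply: eq_bigr => i _ /=.
    by rewrite !mxE; ring.
  rewrite !mxE; move: (v_ge0 i).
  case: (boolP (i \in D)) => [/sD/v_ge1|_]; case: (i \in C);
    rewrite ?mulr1n ?mulr0n; lra.
have /eqP : ind A - ind B = 0.
  apply: (vertex_conv_hull_extreme _ _ _ _ _ v_vertex); first exact: feasible.
  by rewrite opprB; apply: feasible.
rewrite subr_eq0 => /eqP/rowP eq_ind; apply/finset.setP => i.
move: (eq_ind i); rewrite !mxE => /eqP; rewrite eqr_nat.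
by case: (i \in A) (i \in B) => [] [].
Qed.

Theorem theorem4 (R : realType) (n : nat) (a : 'rV[int]_n) (b : int)
    (a_neq0 : a <> 0) (v : 'rV[R]_n)
    (v_vertex : vertex (integer_hull (@knapsack R n a b)) v) :
  #|supp v|%:R <= log2 (351 / 100 * norm2 R (subvector a (supp v))).
Proof.
set S := supp v; set u := subvector a S.
have inj_u : injective (fun A : {set 'I_#|S|} => \sum_(j in A) u 0 j).
  have sub (A : {set 'I_#|S|}) : enum_val @: A \subset S.
    by apply/fintype.subsetP => _ /imsetP[j _ ->]; apply: enum_valP.
  have sumE (A : {set 'I_#|S|}) :
      \sum_(j in A) u 0 j = \sum_(i in enum_val @: A) a 0 i.
    rewrite big_imset /=; last by move=> j k _ _; apply: enum_val_inj.
    by apply: eq_bigr => j _; rewrite mxE.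
  move=> A B; rewrite !sumE => /(vertex_knapsack_subset_sums _ _ _ _ _ _ _ v_vertex).
  by move=> /(_ (sub A) (sub B)); apply: imset_inj; apply: enum_val_inj.
have := distinct_subset_sums_norm _ _ inj_u; rewrite card_ord.
rewrite /norm2 /log2; set q := \sum_j _ => hq.
have -> : \sum_(j < #|S|) (u 0 j)%:~R ^+ 2 = q%:~R :> R.
  by rewrite rmorph_sum; apply: eq_bigr => j _; rewrite rmorphXn.
have ln2_gt0 : 0 < ln 2 :> R by rewrite ln_gt0 ?ltr1n.
rewrite ler_pdivlMr // [leLHS]mulr_natl -lnXn //.
have q_ge0 : 0 <= q by apply: sumr_ge0 => j _; apply: sqr_ge0.
(* For empty support the claim is [0 <= 0], by the default value [ln 0 = 0]. *)
have [S0|S_gt0] := posnP #|S|.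
  rewrite S0 expr0 ln1 [q](_ : _ = 0); first by rewrite sqrtr0 mulr0 ln0.
  by rewrite /q; apply: big1 => j; move: (ltn_ord j); rewrite {2}S0.
have q_ge1 : 1 <= q.
  have : 4 ^+ 1 <= 4 ^+ #|S| :> int by rewrite ler_eXn2l.
  by lia.
have q_gt0 : 0 < q%:~R :> R by rewrite ltr0z; lia.
rewrite ler_ln ?posrE ?exprn_gt0 ?mulr_gt0 ?sqrtr_gt0 //.
rewrite -ler_sqr ?nnegrE ?exprn_ge0 ?mulr_ge0 ?sqrtr_ge0 //.
rewrite exprMn sqr_sqrtr ?ltW // -exprM mulnC exprM.
(* Here [3 * q + 1 <= 4 * q] since [1 <= q]; the goal then follows from [4 <= (351 / 100) ^+ 2]. *)
have : 4 ^+ #|S| <= (4 * q)%:~R :> R.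
  rewrite [leLHS](_ : _ = (4 ^+ #|S| : int)%:~R); last by rewrite rmorphXn.
  by rewrite ler_int; lia.
have -> : 2 ^+ 2 = 4 :> R by rewrite -natrX.
rewrite intrM; lra.
Qed.
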